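(* Let $q$ be a power of a prime $p$, let $j=0$, let $n$ be an integer with $2\le n\le q+2$, and put $k=2j+2+(n-1)(q-1)=2+(n-1)(q-1)$ and $m\equiv j+1=1\pmod{q-1}$. Let $M,D,A,F,T$ be the $n\times n$ matrices over $\mathbb{C}_\infty$ defined in the context (with $j=0$). Then all of the following hold: 1. $\mathrm{Ker}(MA)\cap\mathrm{Ker}(F+MD)=\mathrm{Ker}(MA)\cap F(\mathrm{Ker}(I+MA))=0$; 2. if $q$ is odd, $MD$ is diagonalizable; if $q$ is even, $MD$ is diagonalizable if and only if $\dim_{\mathbb{C}_\infty}S^{1,new}_{k,m}(\Gamma_0(t))\le1$; 3. $S^1_{k,m}(\Gamma_0(t))=S^{1,old}_{k,m}(\Gamma_0(t))\oplus S^{1,new}_{k,m}(\Gamma_0(t))=(\mathrm{Ker}(MA)\oplus\mathrm{Ker}(MD))\oplus(\mathrm{Ker}(T)\cap F\,\mathrm{Ker}(T))$, where $S^1_{k,m}(\Gamma_0(t))$ is identified with $\mathbb{C}_\infty^n$ via the basis described in the context.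
   Context: Modular forms. $K=\mathbb{F}_q(t)$, $K_\infty$ is its completion at $\infty=1/t$, $\mathbb{C}_\infty$ is the completion of an algebraic closure of $K_\infty$, and $\Omega=\mathbb{P}^1(\mathbb{C}_\infty)-\mathbb{P}^1(K_\infty)$ is the Drinfeld upper half plane. For $\gamma=\begin{pmatrix}a&b\\c&d\end{pmatrix}\in GL_2(K_\infty)$ and $\varphi:\Omega\to\mathbb{C}_\infty$ put $(\varphi|_{k,m}\gamma)(z)=\varphi(\gamma z)(\det\gamma)^m(cz+d)^{-k}$. For $\Gamma=GL_2(\mathbb{F}_q[t])$ or $\Gamma=\Gamma_0(t)=\{\begin{pmatrix}a&b\\c&d\end{pmatrix}\in GL_2(\mathbb{F}_q[t]): c\equiv0 \bmod t\}$, $S^1_{k,m}(\Gamma)$ is the (finite dimensional) $\mathbb{C}_\infty$-space of cusp forms of weight $k$ and type $m$: rigid analytic $\varphi:\Omega\to\mathbb{C}_\infty$ with $\varphi|_{k,m}\gamma=\varphi$ for all $\gamma\in\Gamma$, holomorphic and vanishing at all cusps. It depends on $m$ only modulo $q-1$. The Atkin operator on $S^1_{k,m}(\Gamma_0(t))$ is $\mathbf{U}_t(\varphi)(z)=\sum_{b\in\mathbb{F}_q}\varphi\left(\frac{z+b}{t}\right)$; the Hecke operator on $S^1_{k,m}(GL_2(\mathbb{F}_q[t]))$ is $\mathbf{T}_t(\varphi)(z)=t^k\varphi(tz)+\sum_{b\in\mathbb{F}_q}\varphi\left(\frac{z+b}{t}\right)$ (item 1 is the matrix form of $\mathrm{Ker}(\mathbf{T}_t)=0$).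 Oldforms: let $\delta_1,\delta_t:S^1_{k,m}(GL_2(\mathbb{F}_q[t]))\to S^1_{k,m}(\Gamma_0(t))$ be $\delta_1(\varphi)=\varphi$, $\delta_t(\varphi)(z)=t^m\varphi(tz)$, and $\delta(\varphi,\psi)=\delta_1\varphi+\delta_t\psi$; then $S^{1,old}_{k,m}(\Gamma_0(t))=\mathrm{Im}(\delta)$. Newforms: let $\varphi^{Fr}=\varphi|_{k,m}\begin{pmatrix}0&-1\\t&0\end{pmatrix}$ (Fricke involution), $Tr(\varphi)=\sum_{\gamma\in R}\varphi|_{k,m}\gamma$ with $R=\{\mathrm{Id}\}\cup\{\begin{pmatrix}0&-1\\1&b\end{pmatrix}:b\in\mathbb{F}_q\}$, and $Tr'(\varphi)=Tr(\varphi^{Fr})$; then $S^{1,new}_{k,m}(\Gamma_0(t))=\mathrm{Ker}(Tr)\cap\mathrm{Ker}(Tr')$. Basis. Let $\Gamma_1(t)\subset\Gamma_0(t)$ be the subgroup with diagonal entries $\equiv1 \bmod t$. Teitelbaum's residue isomorphism identifies $S^1_{k,m}(\Gamma_1(t))$ with the harmonic cocycles of weight $k$ for $\Gamma_1(t)$: functions $\mathbf{c}$ from oriented edges of the Bruhat-Tits tree of $GL_2(K_\infty)$ (edges $=GL_2(K_\infty)/Z(K_\infty)\mathcal{I}(K_\infty)$, with $\mathcal{I}$ the Iwahori subgroup) to the dual of $V=\bigoplus_{i=0}^{k-2}\mathbb{C}_\infty X^iY^{k-2-i}$ which are harmonic, antisymmetric under edge reversal, and $\Gamma_1(t)$-equivariant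 for the action $(\gamma\omega)(X^iY^{k-2-i})=\det(\gamma)^{1-m}\omega((aX+bY)^i(cX+dY)^{k-2-i})$. Such a cocycle is determined by its value on the edge $\bar e$ represented by $\begin{pmatrix}0&1\\1&0\end{pmatrix}$, and a basis is $\mathbf{c}_0,\dots,\mathbf{c}_{k-2}$ where $\mathbf{c}_i(\bar e)(X^lY^{k-2-l})=1$ if $l=i$ and $0$ otherwise. For $k,j,n,m$ as in the claim, $S^1_{k,m}(\Gamma_0(t))$ has basis $\mathbf{c}_{j+(b-1)(q-1)}$, $1\le b\le n$. Matrices (size $n\times n$). $M=(m_{a,b})$ has entries in $\mathbb{F}_p$: $$m_{a,b}=-\left[\binom{j+(n-a)(q-1)}{j+(n-b)(q-1)}+(-1)^{j+1}\binom{j+(n-a)(q-1)}{j+(b-1)(q-1)}\right]\ (a\ne b),\qquad m_{a,a}=(-1)^j\binom{j+(n-a)(q-1)}{j+(a-1)(q-1)},$$ with $\binom{x}{y}=0$ if $y>x$. With $s_i=j+1+(i-1)(q-1)$: $D=\mathrm{diag}(t^{s_1},\dots,t^{s_n})$; $F$ is the antidiagonal matrix whose entry in row $n+1-b$, column $b$ is $(-t)^{s_b}$; $A$ is the antidiagonal matrix with all antidiagonal entries $(-1)^{j+1}$; $I$ is the identity; $T=I+MA$. In the basis $\mathbf{c}_{j+(b-1)(q-1)}$, $1\le b\le n$, of $S^1_{k,m}(\Gamma_0(t))$ (column convention), $\mathbf{U}_t$ has matrix $MD$, the Fricke involution has matrix $t^{m-k}F$, $Tr$ has matrix $T$, and $Tr'$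 has matrix $t^{m-k}(F+MD)$; moreover $\mathrm{Im}(\delta_1)=\mathrm{Ker}(MA)$, $\mathrm{Im}(\delta_t)=\mathrm{Ker}(MD)$ and newforms are $\mathrm{Ker}(T)\cap F(\mathrm{Ker}(T))$. *)

(* Defs.v *)
From HB Require Import structures.
From mathcomp Require Import all_boot all_order all_algebra.
From mathcomp Require Import boolp classical_sets functions reals.
Set Implicit Arguments. Unset Strict Implicit. Unset Printing Implicit Defensive.
Import Order.TTheory GRing.Theory Num.Theory.
Local Open Scope ring_scope.
Local Open Scope classical_set_scope.

(** * Linear algebra *)

Section LinearAlgebra.
Variables (C : fieldType) (V : lmodType C).
Implicit Types W : set V.

Definition sum_space W1 W2 : set V :=
  [set v | exists2 v1, W1 v1 & exists2 v2, W2 v2 & v = v1 + v2].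

Definition is_direct_sum W W1 W2 : Prop :=
  W = sum_space W1 W2 /\ W1 `&` W2 = [set 0].

Definition lin_comb d (e : 'I_d -> V) (x : 'cV[C]_d) : V :=
  \sum_(i < d) x i 0 *: e i.

Definition is_basis W d (e : 'I_d -> V) : Prop :=
  range (lin_comb e) = W /\ injective (lin_comb e).

Definition has_dim W (d : nat) : Prop := exists e : 'I_d -> V, is_basis W e.

(* Column convention: the b-th column of B lists the coordinates of op (e b). *)
Definition has_matrix d (e : 'I_d -> V) (op : V -> V) (B : 'M[C]_d) : Prop :=
  forall b, op (e b) = lin_comb e (col b B).

End LinearAlgebra.

(* Matrices act on column vectors, so this is not the row kernel [kermx]. *)
Definition Ker (C : fieldType) n (B : 'M[C]_n) : set 'cV[C]_n :=
  [set v | B *m v = 0].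

Definition Img (C : fieldType) n (B : 'M[C]_n) (W : set 'cV[C]_n) :
  set 'cV[C]_n := [set B *m v | v in W].

(** * The matrices M, D, F, A, T *)

(* The indices a, b of type 'I_n start at 0; the mathematical indices, running
   from 1 to n, are a.+1 and b.+1. *)
Section Matrices.
Variables (C : fieldType) (t : C) (q j n : nat).

Definition binC (x y : nat) : C := ('C(x, y))%:R.

Definition matM : 'M[C]_n := \matrix_(a, b)
  let x := (j + (n - a.+1) * q.-1)%N in
  if a == b then (-1) ^+ j * binC x (j + a * q.-1)
  else - (binC x (j + (n - b.+1) * q.-1)
          + (-1) ^+ j.+1 * binC x (j + b * q.-1)).

Definition s_exp (i : 'I_n) : nat := (j.+1 + i * q.-1)%N.

Definition matD : 'M[C]_n := diag_mx (\row_i t ^+ s_exp i).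

Definition matF : 'M[C]_n := \matrix_(a, b)
  if a == rev_ord b then (- t) ^+ s_exp b else 0.

Definition matA : 'M[C]_n := \matrix_(a, b)
  if a == rev_ord b then (-1) ^+ j.+1 else 0.

Definition matT : 'M[C]_n := 1%:M + matM *m matA.

End Matrices.

(** * The field C_infinity *)

Section Field.
Variables (R : realType) (Fq : finFieldType) (C : fieldType).
Variables (iota : {rmorphism {fraction {poly Fq}} -> C}) (abs : C -> R).

Definition embA (P : {poly Fq}) : C := iota (FracField.tofrac P).

Definition tC : C := embA 'X.

(* The topological closure of F_q(t); it is the completion of F_q(t) at 1/t as
   soon as C is complete and abs extends the absolute value at 1/t. *)
Definition Kinf : set C :=
  [set x | forall eps : R, 0 < eps ->
     exists f : {fraction {poly Fq}}, abs (x - iota f) < eps].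

Definition converges (u : nat -> C) (l : C) : Prop :=
  forall eps : R, 0 < eps ->
    exists N, forall i, (N <= i)%N -> abs (u i - l) < eps.

Definition cauchy_seq (u : nat -> C) : Prop :=
  forall eps : R, 0 < eps ->
    exists N, forall i l, (N <= i)%N -> (N <= l)%N -> abs (u i - u l) < eps.

Definition over_Kinf (P : {poly C}) : Prop := forall i, Kinf P`_i.

(* (C, abs) is the completion of an algebraic closure of K_infinity: C is
   complete, every polynomial over K_infinity splits in C, and the elements
   algebraic over K_infinity are dense in C. The absolute value is normalized
   by |t| = q. *)
Record is_Cinf : Prop := IsCinf {
  abs_eq0P : forall x, abs x = 0 <-> x = 0;
  abs_pos : forall x, 0 <= abs x;
  abs_mul : forall x y, abs (x * y) = abs x * abs y;
  abs_ultra : forall x y, abs (x + y) <= Num.max (abs x) (abs y);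
  abs_at_infty : forall P : {poly Fq}, P != 0 ->
    abs (embA P) = #|Fq|%:R ^+ (size P).-1;
  Cinf_complete : forall u, cauchy_seq u -> exists l, converges u l;
  Cinf_split : forall P : {poly C}, over_Kinf P -> P \is monic ->
    exists s : seq C, P = \prod_(x <- s) ('X - x%:P);
  Cinf_dense : forall x (eps : R), 0 < eps ->
    exists2 y, abs (x - y) < eps &
      exists P : {poly C}, [/\ over_Kinf P, P != 0 & root P y]
}.

(** * Drinfeld cusp forms *)

(* The upper half plane is C minus K_infinity. A function on it is represented
   by its extension by 0 to C, so that equality of functions is Leibniz
   equality. Since x / 0 = 0, the slash operators of GL_2(K_infinity) preserve
   extensions by 0. *)
Definition on_Omega (phi : C -> C^o) : Prop := forall z, Kinf z -> phi z = 0.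

Definition im_ge (z : C) (r : R) : Prop :=
  forall x, Kinf x -> r <= abs (z - x).

(* The standard exhaustion of the upper half plane by affinoids:
   |z| <= q^N and inf_(x in K_infinity) |z - x| >= q^-N. *)
Definition Omega_aff (N : nat) : set C :=
  [set z | abs z <= #|Fq|%:R ^+ N /\ im_ge z (#|Fq|%:R ^- N)].

(* On each affinoid, a uniform limit of rational functions without poles. *)
Definition rigid_analytic (phi : C -> C^o) : Prop :=
  forall (N : nat) (eps : R), 0 < eps ->
    exists P Q : {poly C}, forall z, Omega_aff N z ->
      Q.[z] != 0 /\ abs (phi z - P.[z] / Q.[z]) < eps.

Definition mat2 (a b c d : C) : 'M[C]_2 :=
  \matrix_(i < 2, l < 2)
    if i == 0 then (if l == 0 then a else b) else (if l == 0 then c else d).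

Definition slash (k : nat) (m : int) (phi : C -> C^o) (g : 'M[C]_2) :
    C -> C^o :=
  fun z => phi ((g 0 0 * z + g 0 1) / (g 1 0 * z + g 1 1))
           * (\det g) ^ m * (g 1 0 * z + g 1 1) ^- k.

Definition embM (g : 'M[{poly Fq}]_2) : 'M[C]_2 := map_mx embA g.

Definition GL2A : set 'M[{poly Fq}]_2 := [set g | g \in unitmx].

Definition Gamma0t : set 'M[{poly Fq}]_2 :=
  [set g | g \in unitmx /\ ('X %| g 1 0)%R].

(* Truncated exponential of the lattice t F_q[t]: the product runs over the
   nonzero t * a with a of degree < d. *)
Definition exp_tA_trunc (d : nat) (z : C) : C :=
  z * \prod_(v : 'rV[Fq]_d | v != 0) (1 - z / embA ('X * rVpoly v)).

Definition exp_tA (z : C) : C :=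
  xget 0 [set w | converges (fun d => exp_tA_trunc d z) w].

Definition u_inf (z : C) : C := (exp_tA z)^-1.

(* For |z|_i large, phi has an expansion in u_inf without constant term. *)
Definition vanishes_at_inf (phi : C -> C^o) : Prop :=
  exists (a : nat -> C) (r : R), 0 < r /\
    forall z, im_ge z r ->
      converges (fun N => \sum_(i < N) a i * u_inf z ^+ i.+1) (phi z).

(* The translations by t F_q[t] are conjugate into Gamma by every g in
   GL_2(F_q[t]), for both Gamma = GL_2(F_q[t]) and Gamma = Gamma_0(t), as both
   contain Gamma(t); hence u_inf can serve as parameter at all cusps. *)
Definition cusp_form (Gamma : set 'M[{poly Fq}]_2) (k : nat) (m : int) :
    set (C -> C^o) :=
  [set phi | [/\ on_Omega phi, rigid_analytic phi,
     forall g, Gamma g -> slash k m phi (embM g) = phi &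
     forall g, GL2A g -> vanishes_at_inf (slash k m phi (embM g))]].

(** * Atkin operator, Fricke involution, traces, oldforms and newforms *)

Definition Ut (phi : C -> C^o) : C -> C^o :=
  fun z => \sum_(b : Fq) phi ((z + embA b%:P) / tC).

Section Operators.
Variables (k : nat) (m : int).

Definition Fricke (phi : C -> C^o) : C -> C^o :=
  slash k m phi (mat2 0 (-1) tC 0).

Definition Trace (phi : C -> C^o) : C -> C^o :=
  phi + \sum_(b : Fq) slash k m phi (mat2 0 (-1) 1 (embA b%:P)).

Definition Trace' (phi : C -> C^o) : C -> C^o := Trace (Fricke phi).

Definition delta1 (phi : C -> C^o) : C -> C^o := phi.

Definition deltat (phi : C -> C^o) : C -> C^o :=
  fun z => tC ^ m * phi (tC * z).

Definition S_old : set (C -> C^o) :=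
  [set f | exists2 phi, cusp_form GL2A k m phi &
           exists2 psi, cusp_form GL2A k m psi &
           f = delta1 phi + deltat psi].

Definition S_new : set (C -> C^o) :=
  [set f | [/\ cusp_form Gamma0t k m f, Trace f = 0 & Trace' f = 0]].

(* The identification of S^1_{k,m}(Gamma_0(t)) with C^n. The basis c_i dual to
   the residues at the edge (0 1; 1 0), with i = j + (b-1)(q-1), enters through
   the matrices it gives: M D for U_t and t^(m-k) F for the Fricke involution.
   They force the matrices t^(m-k) (F + M D) of Tr' and T of Tr, because
   Tr' = Fr + t^(m-k) U_t, A F = D and the Fricke involution is invertible. *)
Definition adapted_basis (j n : nat) (e : 'I_n -> C -> C^o) : Prop :=
  [/\ is_basis (cusp_form Gamma0t k m) e,
      has_matrix e Ut (matM C #|Fq| j n *m matD tC #|Fq| j n) &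
      has_matrix e Fricke (tC ^ (m - k%:Z) *: matF tC #|Fq| j n)].

End Operators.

End Field.

(* Main.v *)
Require Import Defs.
From HB Require Import structures.
From mathcomp Require Import all_boot all_order all_algebra finfield.
From mathcomp Require Import boolp classical_sets functions reals.
From mathcomp Require Import ring lra zify.
Set Implicit Arguments. Unset Strict Implicit. Unset Printing Implicit Defensive.
Import Order.TTheory GRing.Theory Num.Theory.
Local Open Scope ring_scope.
Local Open Scope classical_set_scope.

(* By Lucas' theorem, for [n <= q + 2] the binomials in [M] collapse and
   [T v = (v_1 - v_n) u] with [u = (1, ..., 1, 0)]. As [D = A F] and
   [F^2 = (- t)^k], everything follows: [Ker (M A)] is the line of [u],
   [Ker (M D) = F (Ker (M A))], and [Ker T] and [F (Ker T)] meet in the space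
   [W] of vectors with [v_1 = v_n = 0]. Moreover [M D (M D - t)] maps into [W],
   on which [M D = - F] is a square root of [(- t)^k]: it is diagonalizable in
   odd characteristic, and in characteristic 2 exactly when [F] is scalar on
   [W], that is when [dim W = n - 2 <= 1].

   For the forms, [Tr' = Fr + t^(m-k) U_t] and [Tr' = Tr o Fr] turn the matrices
   of [U_t] and [Fr] into those of [Tr'] and [Tr]. A form for [Gamma_0(t)] is
   fixed by [Tr] iff it is invariant under [GL_2(F_q[t])], because right
   multiplication permutes the cosets of [Gamma_0(t)], and [delta_t] agrees with
   [Fr] on invariant forms. *)

(** * Binomial coefficients in characteristic p *)

Lemma coef_X1_exp (R : nzRingType) (n i : nat) :
  (('X + 1 : {poly R}) ^+ n)`_i = 'C(n, i)%:R.
Proof.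
elim: n i => [|n IHn] i; first by rewrite expr0 coef1; case: i.
rewrite exprSr mulrDr mulr1 coefD coefMX.
by case: i => [|i] /=; rewrite !IHn ?bin0 ?add0r // binS natrD addrC.
Qed.

Section Binomials.
Variables (C : fieldType) (p r q : nat).
Hypotheses (pC : p \in [pchar C]) (q_def : q = (p ^ r)%N) (r_gt0 : (0 < r)%N).

Lemma prime_power_gt1 : (1 < q)%N.
Proof. by rewrite q_def -(exp1n r) ltn_exp2r // prime_gt1 // (pcharf_prime pC). Qed.

Lemma pchar_nat_exp (R : nzRingType) s : p \in [pchar R] -> [pchar R].-nat (p ^ s)%N.
Proof.
move=> pR; rewrite pnatX; apply/orP; left.
by rewrite (eq_pnat _ (pcharf_eq pR)) pnat_id // (pcharf_prime pR).
Qed.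

Lemma signr_q : (-1) ^+ q = -1 :> C.
Proof. by rewrite exprNn_pchar ?expr1n // q_def pchar_nat_exp. Qed.

Lemma signr_predq : (-1) ^+ q.-1 = 1 :> C.
Proof.
have := signr_q; rewrite -(prednK (ltnW prime_power_gt1)) exprS mulN1r.
exact: oppr_inj.
Qed.

(** Compare coefficients in [(X + 1)^(x + q) = (X + 1)^x (X^q + 1)]. *)
Lemma bin_addq x y :
  'C(x + q, y)%:R = 'C(x, y)%:R + (if (y < q)%N then 0 else 'C(x, y - q)%:R) :> C.
Proof.
have pP : p \in [pchar {poly C}] by apply: rmorph_pchar (polyC) _ pC.
rewrite -coef_X1_exp exprD [X in _ * X]exprDn_pchar; last first.
  by rewrite q_def pchar_nat_exp.
by rewrite expr1n mulrDr mulr1 coefD coefMXn !coef_X1_exp addrC.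
Qed.

(** Lucas' theorem for one digit in base [q]: by [bin_addq], the upper digits [a] and [c] obey
    Pascal's rule. *)
Lemma bin_lucas a b c d : (b < q)%N -> (d < q)%N ->
  'C(a * q + b, c * q + d)%:R = 'C(a, c)%:R * 'C(b, d)%:R :> C.
Proof.
move=> bq dq; elim: a c => [|a IHa] [|c].
- by rewrite bin0 mul1r.
- by rewrite bin_small 1?bin_small ?mul0r //; lia.
- by rewrite mulSnr addnAC bin_addq mul0n add0n dq addr0 (IHa 0%N) !bin0.
- rewrite mulSnr addnAC bin_addq IHa ifF; last by apply/negbTE; rewrite -leqNgt; lia.
  have -> : (c.+1 * q + d - q = c * q + d)%N by lia.
  by rewrite IHa binS natrD mulrDl.
Qed.

(** Neighbouring binomials add up to ['C(p ^ s, y.+1)], which vanishes because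
    [(X + 1)^(p^s) = X^(p^s) + 1]; so the signs alternate. *)
Lemma bin_pred_prime_power s y : (y < p ^ s)%N ->
  'C((p ^ s).-1, y)%:R = (-1) ^+ y :> C.
Proof.
have p_gt0 : (0 < p ^ s)%N by rewrite expn_gt0 prime_gt0 ?(pcharf_prime pC).
have pP : p \in [pchar {poly C}] by apply: rmorph_pchar (polyC) _ pC.
elim: y => [_|y IHy yp]; first by rewrite bin0.
apply/eqP; rewrite exprS mulN1r -IHy; last exact: ltnW.
rewrite -addr_eq0 -natrD -binS prednK // -coef_X1_exp exprDn_pchar ?pchar_nat_exp //.
by rewrite expr1n coefD coefXn coef1 addr0 (ltn_eqF yp).
Qed.

(* For [x <= q], write [x * (q - 1) = (x - 1) * q + (q - x)] and apply Lucas;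
   [(q + 1) * (q - 1)] is one less than the prime power [q ^ 2]. *)
Lemma bin_mul_predq x y : (x <= q.+1)%N ->
  'C(x * q.-1, y * q.-1)%:R =
    ((x == y) || (y == 0%N) || (x == q.+1) && (y <= x)%N)%:R :> C.
Proof.
have q_gt1 := prime_power_gt1.
case: y => [|y]; first by rewrite mul0n bin0 orbT.
rewrite leq_eqVlt ltnS [y.+1 == 0%N]gtn_eqF //  orbF => /orP[/eqP ->|x_le].
  rewrite eqxx andTb.
  have -> : (q.+1 * q.-1 = (p ^ (r * 2)).-1)%N.
    by rewrite expnM -q_def -mulnn; nia.
  case: (leqP y.+1 q.+1) => yq.
    rewrite orbT bin_pred_prime_power ?[(y.+1 * _)%N]mulnC ?exprM ?signr_predq ?expr1n //.
    by rewrite expnM -q_def -mulnn; nia.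
  rewrite orbF [_ == _]ltn_eqF // bin_small // expnM -q_def -mulnn; nia.
rewrite (ltn_eqF (_ : x < q.+1)%N) // andFb orbF.
case: x x_le => [|x] xq; first by rewrite bin0n; rewrite gtn_eqF // muln_gt0 -subn1 subn_gt0.
case: (ltngtP x y) => [xy|xy|<-]; last by rewrite eqxx binn.
  by rewrite bin_small ?eqSS ?(ltn_eqF xy) //; nia.
(* As [y < x], the lower digit [q - x.+1] is less than [q - y.+1], which kills the second factor in
   Lucas' formula. *)
have -> : (x.+1 * q.-1 = x * q + (q - x.+1))%N by nia.
have -> : (y.+1 * q.-1 = y * q + (q - y.+1))%N by nia.
rewrite bin_lucas; try lia.
by rewrite [X in _ * X%:R]bin_small ?mulr0 ?eqSS ?(gtn_eqF xy) //; lia.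
Qed.
End Binomials.

(** * Criteria for diagonalizability *)

(** In an eigenbasis, each eigenvalue occurring in [v] is a square root of [c]; square roots are
    unique in characteristic 2, so at most one eigenvalue occurs. *)
Lemma diagonalizable_sq_scalar_pchar2 (C : fieldType) n (B : 'M[C]_n)
    (v : 'cV[C]_n) (c : C) :
  2%N \in [pchar C] -> diagonalizable B -> B *m (B *m v) = c *: v ->
  exists a, B *m v = a *: v.
Proof.
move=> C2 [P Pu /diagonalizable_forPex[d /(simmxP Pu) PB]] BBv.
have [u Pv] : exists u, P *m v = u by exists (P *m v).
have Bu w : P *m (B *m w) = diag_mx d *m (P *m w) by rewrite !mulmxA PB.
have du i : d 0 i ^+ 2 * u i 0 = c * u i 0.
  have := congr1 (fun w : 'cV_n => w i 0) (congr1 (mulmx P) BBv).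
  by rewrite !Bu -scalemxAr Pv !mul_diag_mx !mxE mulrA.
have [u0|/cV0Pn[i0 ui0]] := eqVneq u 0.
  exists 0; have -> : v = 0 by rewrite -(mulKmx Pu v) Pv u0 mulmx0.
  by rewrite mulmx0 scaler0.
exists (d 0 i0); apply: (can_inj (mulKmx Pu)); apply/colP => i.
rewrite Bu -scalemxAr Pv mul_diag_mx !mxE.
have [->|ui] := eqVneq (u i 0) 0; first by rewrite !mulr0.
have dc l : u l 0 != 0 -> d 0 l ^+ 2 = c by move=> /mulIf; apply; apply: du.
congr (_ * _); apply/eqP; rewrite -subr_eq0 -sqrf_eq0 sqrrB dc // dc // -mulr_natr.
by rewrite (pcharf0 C2) mulr0 subr0 -mulr2n -mulr_natr (pcharf0 C2) mulr0.
Qed.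

(** The fold applies the product of the factors [B - a] to [v], the last entry of [rs] acting first.
    If it kills every vector, the minimal polynomial divides a product of distinct linear
    factors. *)
Lemma diagonalizable_of_roots (C : fieldType) n (B : 'M[C]_n.+1) (rs : seq C) :
  uniq rs -> (forall v : 'cV[C]_n.+1, foldr (fun a w => B *m w - a *: w) v rs = 0) ->
  diagonalizable B.
Proof.
move=> rs_uniq Bv; apply/diagonalizableP; exists rs => //; apply: mxminpoly_min.
rewrite -[LHS]mulmx1; apply/matrixP => i l.
transitivity ((horner_mx B (\prod_(x <- rs) ('X - x%:P)) *m col l 1%:M) i 0).
  by rewrite !mxE; apply: eq_bigr => h _; rewrite !mxE.
have E v : horner_mx B (\prod_(x <- rs) ('X - x%:P)) *m v =
    foldr (fun a w => B *m w - a *: w) v rs; last first.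
  by rewrite E Bv !mxE.
elim: rs {rs_uniq Bv} => [|a rs IHrs] /=; first by rewrite big_nil rmorph1 mul1mx.
rewrite big_cons rmorphM /= -mulmxA IHrs rmorphB /= horner_mx_X horner_mx_C.
by rewrite mulmxBl mul_scalar_mx.
Qed.

(** * The matrices and their kernels in coordinates *)

Lemma Ker_scale (C : fieldType) n (B : 'M[C]_n) c (v : 'cV[C]_n) : Ker B v -> Ker B (c *: v).
Proof. by rewrite /Ker /= -scalemxAr => ->; rewrite scaler0. Qed.

Section Coordinates.
Variables (C : fieldType) (q N : nat) (t : C).
Local Notation n := N.+2.
Local Notation k := (2 + n.-1 * q.-1)%N.
Local Notation M := (matM C q 0 n).
Local Notation D := (matD t q 0 n).
Local Notation A := (matA C 0 n).
Local Notation F := (matF t q 0 n).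
Local Notation T := (matT C q 0 n).
Implicit Types v w : 'cV[C]_n.

(** On the diagonal the first binomial is 1 and cancels the Kronecker delta, so one formula serves
    both cases. *)
Lemma matME a b : M a b = (a == b)%:R
   - (binC C ((n - a.+1) * q.-1) ((n - b.+1) * q.-1)
      - binC C ((n - a.+1) * q.-1) (b * q.-1)).
Proof.
rewrite mxE !add0n /= expr0 expr1 mulN1r mul1r !subSS.
have [->|_] := eqVneq a b; last by rewrite sub0r.
by rewrite /binC binn subKr.
Qed.

Definition old_vec : 'cV[C]_n := \col_i (i != ord_max)%:R.
Local Notation u := old_vec.

Let u0 : u ord0 0 = 1. Proof. by rewrite mxE. Qed.
Let u_max : u ord_max 0 = 0. Proof. by rewrite mxE eqxx. Qed.

Let Zu0 c : (c *: u) ord0 0 = c. Proof. by rewrite mxE u0 mulr1. Qed.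
Let Zu_max c : (c *: u) ord_max 0 = 0. Proof. by rewrite mxE u_max mulr0. Qed.

Lemma mul_matFE v a : (F *m v) a 0 = (- t) ^+ s_exp q 0 (rev_ord a) * v (rev_ord a) 0.
Proof.
rewrite mxE (bigD1 (rev_ord a)) //= mxE rev_ordK eqxx big1 ?addr0 // => i ia.
by rewrite mxE -(inj_eq rev_ord_inj) rev_ordK eq_sym (negbTE ia) mul0r.
Qed.

(** The exponents of [F] at mirrored indices add up to [k]. *)
Lemma mul_matFF v : F *m (F *m v) = (- t) ^+ k *: v.
Proof.
apply/colP => a; rewrite !mul_matFE rev_ordK mulrA -exprD [RHS]mxE /s_exp.
by congr (_ ^+ _ * _); case: a => a an /=; nia.
Qed.

Let rev0 : rev_ord ord0 = ord_max :> 'I_n.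
Proof. by apply: val_inj; rewrite /= subn1. Qed.
Let rev_max : rev_ord ord_max = ord0 :> 'I_n.
Proof. by apply: val_inj; rewrite /= subnn. Qed.

Lemma mul_matF_max v : (F *m v) ord_max 0 = - t * v ord0 0.
Proof. by rewrite mul_matFE rev_max. Qed.

Lemma mul_matF0 v : (F *m v) ord0 0 = (- t) ^+ s_exp q 0 (@ord_max N.+1) * v ord_max 0.
Proof. by rewrite mul_matFE rev0. Qed.

Lemma mul_matMA v : M *m A *m v = T *m v - v.
Proof. by rewrite /matT mulmxDl mul1mx addrC addKr. Qed.

Lemma Ker_matMA v : Ker (M *m A) v <-> T *m v = v.
Proof. by rewrite /Ker /= mul_matMA; split=> [/eqP|->]; rewrite ?subr_eq0 ?subrr // => /eqP. Qed.

Hypothesis t_neq0 : t != 0.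
Let Ft_neq0 i : (- t) ^+ i != 0. Proof. by rewrite expf_neq0 // oppr_eq0. Qed.

(** Up to a nonzero scalar [F] is its own inverse, so membership in an image becomes a condition on
    [F *m v]. *)
Lemma Img_matF (W : set 'cV[C]_n) :
  (forall c v, W v -> W (c *: v)) -> forall v, Img F W v <-> W (F *m v).
Proof.
move=> WZ v; split=> [[w Ww <-]|WFv]; first by rewrite mul_matFF; apply: WZ.
exists ((- t) ^- k *: (F *m v)); first exact: WZ.
by rewrite -scalemxAr mul_matFF scalerA mulVf ?scale1r.
Qed.

Lemma matF_eq0 v : F *m v = 0 -> v = 0.
Proof.
move=> Fv; have := mul_matFF v; rewrite Fv mulmx0 => /esym/eqP.
by rewrite scaler_eq0 (negbTE (Ft_neq0 _)) => /eqP.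
Qed.

Variables p r : nat.
Hypotheses (pC : p \in [pchar C]) (q_def : q = (p ^ r)%N) (r_gt0 : (0 < r)%N).
Hypothesis N_le : (N <= q)%N.
Hypothesis t_free : forall i, (0 < i)%N -> t ^+ i != 1.

Let q_gt1 : (1 < q)%N := prime_power_gt1 pC q_def r_gt0.

(** With [x = n - a.+1], at most [q + 1] as [N <= q], [bin_mul_predq] evaluates both binomials. In
    general the terms with [x = y] cancel the Kronecker deltas, and those with [y = 0] leave the
    first and last columns. For [x = q + 1] the binomials are both 1 and the deltas are these
    columns; in the last row [x = 0] and everything cancels. *)
Lemma matT_entry a b :
  T a b = (a != ord_max)%:R * ((b == ord0)%:R - (b == ord_max)%:R).
Proof.
have -> : T a b = (a == b)%:R - M a (rev_ord b).
  rewrite /matT mxE mxE; congr (_ + _).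
  rewrite mxE (bigD1 (rev_ord b)) //= [A _ _]mxE eqxx expr1 mulrN1 big1 ?addr0 // => i.
  by move=> /negbTE ib; rewrite [A _ _]mxE ib mulr0.
rewrite matME /binC /=.
have -> : (n - (n - b.+1).+1 = b)%N by case: b => b /= bn; lia.
have -> : (a == b)%:R = ((n - a.+1)%N == (n - b.+1)%N)%:R :> C.
  congr (_%:R); congr nat_of_bool; rewrite -val_eqE /=; case: a b => a an [b bn] /=; lia.
have -> : (a == rev_ord b)%:R = ((n - a.+1)%N == b)%:R :> C.
  congr (_%:R); congr nat_of_bool; rewrite -val_eqE /=; case: a b => a an [b bn] /=; lia.
rewrite !(bin_mul_predq pC q_def r_gt0); try lia.
rewrite -!val_eqE /= !subSS; case: a b => a a_lt [b b_lt] /=.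
(* Split on every index comparison; [lia] discards the impossible combinations. *)
repeat match goal with |- context [nat_of_bool ?e] => lazymatch e with
  | true => fail | false => fail
  | _ => let H := fresh in case: (boolP e) => H; try (exfalso; lia) end end.
all: rewrite /= ?mulr0n ?mulr1n; ring.
Qed.
Lemma mul_matT v : T *m v = (v ord0 0 - v ord_max 0) *: u.
Proof.
apply/colP => a; rewrite [LHS]mxE [RHS]mxE [u _ _]mxE.
under eq_bigr do rewrite matT_entry -mulrA mulrBl.
rewrite -mulr_sumr sumrB (bigD1 ord0) //= mul1r big1 ?addr0; last first.
  by move=> i /negbTE ->; rewrite mul0r.
rewrite (bigD1 ord_max) //= eqxx mul1r big1 ?addr0 1?mulrC //.
by move=> i /negbTE ->; rewrite mul0r.
Qed.

(** Each [s_b] is 1 plus a multiple of [q - 1], so [(- t)^(s_b) = - t^(s_b)], and the entry -1 of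
    [A] removes the sign. *)
Lemma matD_AF : D = A *m F.
Proof.
apply/matrixP => a b; rewrite !mxE (bigD1 (rev_ord b)) //= !mxE eqxx big1 ?addr0; last first.
  by move=> i /negbTE ib; rewrite [F _ _]mxE ib mulr0.
rewrite rev_ordK expr1 /s_exp add1n !exprS.
have -> : (- t) ^+ (b * q.-1) = t ^+ (b * q.-1).
  by rewrite exprNn mulnC [(-1) ^+ _]exprM (signr_predq pC q_def r_gt0) expr1n mul1r.
have [->|_] := eqVneq a b; last by rewrite mul0r.
by rewrite mulr1n; ring.
Qed.

(** Matrix form of [Tr' = Fr + t^(m-k) U_t]: [T F = F + M A F = F + M D]. *)
Lemma matMD_T : M *m D = T *m F - F.
Proof. by rewrite matD_AF mulmxA /matT mulmxDl mul1mx addrC addKr. Qed.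

Lemma mul_matMD v : M *m D *m v = T *m (F *m v) - F *m v.
Proof. by rewrite matMD_T mulmxBl mulmxA. Qed.

Lemma Ker_matMAE v : Ker (M *m A) v <-> v = v ord0 0 *: u.
Proof.
rewrite Ker_matMA mul_matT; split=> [vE|->]; last first.
  by rewrite !Zu0 Zu_max subr0.
have v0 : v ord_max 0 = 0 by rewrite -vE Zu_max.
by rewrite -[LHS]vE v0 subr0.
Qed.

Lemma Ker_matMD v : Ker (M *m D) v <-> Ker (M *m A) (F *m v).
Proof. by rewrite /Ker /= mul_matMD mul_matMA. Qed.

Lemma Ker_matFMD v : Ker (F + M *m D) v <-> Ker T (F *m v).
Proof. by rewrite /Ker /= matMD_T addrC subrK mulmxA. Qed.

Lemma Ker_matT v : Ker T v <-> v ord0 0 = v ord_max 0.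
Proof.
rewrite /Ker /= mul_matT; split=> [/colP/(_ ord0)|->]; last by rewrite subrr scale0r.
by rewrite Zu0 mxE => /eqP; rewrite subr_eq0 => /eqP.
Qed.

Lemma newspaceE v : (Ker T `&` Img F (Ker T)) v <->
  v ord0 0 = 0 /\ v ord_max 0 = 0.
Proof.
rewrite /setI /mkset (Img_matF (@Ker_scale _ _ T)) !Ker_matT !mul_matFE rev0 rev_max.
split=> [[v0 /eqP]|[-> ->]]; last by rewrite !mulr0.
(* With [v_1 = v_n], the second condition reads [((- t)^(s_n) + t) v_1 = 0]; the factor is nonzero
   because [s_n > 1] and [t] is not a root of unity. *)
rewrite -v0 -subr_eq0 -mulrBl mulf_eq0 => /orP[|/eqP //].
rewrite /s_exp !add1n /= mul0n !exprS expr0 -mulrBr mulf_eq0 oppr_eq0 (negbTE t_neq0) /=.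
rewrite subr_eq0 exprNn mulnC [(-1) ^+ _]exprM (signr_predq pC q_def r_gt0) expr1n mul1r.
by rewrite (negbTE (t_free _)) // muln_gt0 -subn1 subn_gt0 q_gt1.
Qed.

Lemma setI_KerMA_KerFMD :
  (Ker (M *m A) `&` Ker (F + M *m D) = Ker (M *m A) `&` Img F (Ker T)).
Proof.
apply/seteqP; split=> v [uv Tv]; split=> //; first exact/(Img_matF (@Ker_scale _ _ T))/Ker_matFMD.
by apply/Ker_matFMD/(Img_matF (@Ker_scale _ _ T)).
Qed.

(** For [v = c u], the vector [F v] begins with 0 and ends with [- t c]; it lies in [Ker T] only if
    these agree. *)
Lemma setI_KerMA_FKerT : (Ker (M *m A) `&` Img F (Ker T) = [set 0]).
Proof.
apply/seteqP; split=> [v [/Ker_matMAE vE /(Img_matF (@Ker_scale _ _ T))]|v ->]; last first.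
  by split; [rewrite /Ker /= mulmx0|exists 0; rewrite /Ker /= ?mulmx0].
rewrite Ker_matT mul_matF_max mul_matF0 vE Zu_max Zu0 mulr0 => /esym/eqP.
by rewrite mulf_eq0 oppr_eq0 (negbTE t_neq0) => /eqP ->; rewrite scale0r.
Qed.

(** [F v] is a multiple of [u], so its last coordinate [- t v_1] vanishes. *)
Lemma Ker_matMD_coords v : Ker (M *m D) v -> v ord0 0 = 0.
Proof.
move=> /Ker_matMD/Ker_matMAE/(congr1 (fun w : 'cV[C]_n => w ord_max 0)).
rewrite Zu_max mul_matF_max => /eqP.
by rewrite mulf_eq0 oppr_eq0 (negbTE t_neq0) => /eqP.
Qed.

Lemma Ker_matMD_eq0 v : Ker (M *m D) v -> v ord_max 0 = 0 -> v = 0.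
Proof.
move=> /Ker_matMD/Ker_matMAE FvE v_max; apply: matF_eq0.
by rewrite FvE mul_matF0 v_max mulr0 scale0r.
Qed.

Lemma oldspace_direct : is_direct_sum (sum_space (Ker (M *m A)) (Ker (M *m D)))
  (Ker (M *m A)) (Ker (M *m D)).
Proof.
split=> //; apply/seteqP; split=> [v [/Ker_matMAE vE /Ker_matMD_coords v0]|v ->].
  by rewrite vE v0 scale0r.
by split; rewrite /Ker /= mulmx0.
Qed.

Lemma old_new_direct : is_direct_sum [set: 'cV[C]_n]
  (sum_space (Ker (M *m A)) (Ker (M *m D))) (Ker T `&` Img F (Ker T)).
Proof.
split; apply/seteqP.
  (* [F u] begins with 0 and ends with [- t], so [v_1 u + b F u] has the same first and last
     coordinates as [v]. *)
  split=> // v _; pose b := - (v ord_max 0 / t).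
  exists (v ord0 0 *: u + b *: (F *m u)).
    exists (v ord0 0 *: u); first by rewrite Ker_matMAE Zu0.
    exists (b *: (F *m u)) => //; apply/Ker_scale/Ker_matMD; rewrite mul_matFF.
    by rewrite Ker_matMAE Zu0.
  exists (v - (v ord0 0 *: u + b *: (F *m u))); last by rewrite addrC subrK.
  rewrite newspaceE; split; rewrite mxE [X in _ + X]mxE [X in - X]mxE.
    by rewrite Zu0 mxE mul_matF0 u_max !mulr0 addr0 subrr.
  by rewrite Zu_max mxE mul_matF_max u0 mulr1 add0r /b mulrNN divfK ?subrr.
split=> [v [[v1 v1A [v2 v2D ->]]]|v ->]; last first.
  split; last by rewrite newspaceE !mxE.
  by exists 0; [|exists 0; [|rewrite addr0]]; rewrite /Ker /= ?mulmx0.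
(* The first coordinate kills the multiple of [u]; the last one then kills the part in
   [Ker (M D)]. *)
move: v1A => /Ker_matMAE v1E /newspaceE[].
rewrite !mxE (Ker_matMD_coords v2D) addr0 => v10.
rewrite v1E v10 scale0r mxE add0r => v2_max.
by rewrite (Ker_matMD_eq0 v2D v2_max) addr0.
Qed.

Lemma matMD_newspace v : v ord0 0 = 0 -> v ord_max 0 = 0 -> M *m D *m v = - (F *m v).
Proof.
by move=> v0 v_max; rewrite mul_matMD mul_matT mul_matF0 mul_matF_max v0 v_max !mulr0
  subr0 scale0r sub0r.
Qed.

(* [MD (MD - t)] maps into the subspace [v_1 = v_n = 0]. *)
Lemma matMD_into_newspace v (w := M *m D *m v - t *: v) :
  (M *m D *m w - 0 *: w) ord0 0 = 0 /\ (M *m D *m w - 0 *: w) ord_max 0 = 0.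
Proof.
(* The first and last coordinates of [M D x] are both [t x_1], hence [w_1 = 0]. The term [0 *: w]
   matches the root 0 in [diagonalizable_of_roots]. *)
have B0 (x : 'cV[C]_n) : (M *m D *m x) ord0 0 = t * x ord0 0.
  by rewrite mul_matMD mul_matT mxE Zu0 [X in _ + X]mxE mul_matF_max; ring.
have B_max (x : 'cV[C]_n) : (M *m D *m x) ord_max 0 = t * x ord0 0.
  by rewrite mul_matMD mul_matT mxE Zu_max [X in _ + X]mxE mul_matF_max; ring.
have w_eq : w ord0 0 = 0 by rewrite /w mxE B0 !mxE subrr.
by rewrite scale0r subr0 B0 B_max w_eq mulr0.
Qed.

Let t_exp_inj i l : t ^+ i = t ^+ l -> i = l.
Proof.
wlog le_il : i l / (i <= l)%N => [hw|].
  by case/orP: (leq_total i l) => ? E; [apply: hw|apply/esym/hw].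
rewrite -{1}(subnK le_il) exprD -[LHS]mul1r => /(mulIf (expf_neq0 _ t_neq0))/esym/eqP tE.
by apply/eqP; rewrite eqn_leq le_il -subn_eq0; apply: contraLR tE; rewrite -lt0n; apply: t_free.
Qed.

Let matMD_FF v : v ord0 0 = 0 -> v ord_max 0 = 0 -> M *m D *m (M *m D *m v) = (- t) ^+ k *: v.
Proof.
move=> v0 v_max; rewrite (matMD_newspace v0 v_max) mulmxN matMD_newspace.
- by rewrite opprK mul_matFF.
- by rewrite mul_matF0 v_max mulr0.
- by rewrite mul_matF_max v0 mulr0.
Qed.

Lemma diagonalizable_odd : odd q -> diagonalizable (M *m D).
Proof.
(* As [q - 1] is even, so is [k], and [mu] is a square root of [(- t)^k]. *)
move=> q_odd; pose mu := (- t) ^+ k./2.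
have q1_even : ~~ odd q.-1 by move: q_odd; rewrite -{1}(prednK (ltnW q_gt1)).
have k_even : odd k = false by rewrite oddD oddM (negbTE q1_even) andbF.
have mu2 : mu ^+ 2 = (- t) ^+ k by rewrite -exprM muln2 halfK k_even subn0.
have mu0 : mu != 0 by apply: Ft_neq0.
(* [mu ^+ 2] is [t ^+ k] with [k > 2]; this keeps both [mu] and [- mu] apart from [t]. *)
have mut : mu ^+ 2 != t ^+ 2.
  rewrite mu2 exprNn -signr_odd k_even mul1r; apply/eqP => /t_exp_inj; nia.
have two_neq0 : 2%:R != 0 :> C.
  rewrite -(dvdn_pcharf pC) dvdn_prime2 ?(pcharf_prime pC) //; apply: contraL q_odd => /eqP p2.
  by rewrite q_def p2 oddX /= orbF -lt0n.
(* The factors for [t] and 0 act first and land in [W], where [M D] squares to [mu ^+ 2]. *)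
apply: (@diagonalizable_of_roots _ _ _ [:: mu; - mu; 0; t]) => [|v /=].
  have muN : mu != - mu by rewrite -addr_eq0 -mulr2n -mulr_natl mulf_neq0.
  have mu_t : mu != t by apply: contraNneq mut => ->.
  have muN_t : - mu != t by apply: contraNneq mut => <-; rewrite sqrrN.
  by rewrite /= !inE !negb_or oppr_eq0 mu0 muN mu_t muN_t [0 == t]eq_sym t_neq0.
have [w0 w_max] := matMD_into_newspace v; move: (_ - 0 *: _) w0 w_max => w w0 w_max.
rewrite mulmxBr matMD_FF // -scalemxAr !scaleNr !opprK scalerDr scalerA -mu2 expr2.
by rewrite [X in _ - X]addrC subrr.
Qed.

Lemma diagonalizable_even : ~~ odd q -> diagonalizable (M *m D) <-> (N <= 1)%N.
Proof.
move=> q_even.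
have C2 : 2%N \in [pchar C].
  have p2 : p = 2%N.
    apply/eqP; move: q_even; rewrite q_def oddX negb_or -lt0n r_gt0 /=.
    by case: (even_prime (pcharf_prime pC)) => [->|->].
  by rewrite -p2.
split=> [BD|].
  rewrite leqNgt; apply/negP => N_gt1.
  have lt1 : (1 < n)%N by [].
  (* The second unit vector lies in [W], and [F] sends it to a nonzero multiple of the last but one,
     a different vector as [n >= 4]. *)
  pose v : 'cV[C]_n := delta_mx (Ordinal lt1) 0.
  have v0 : v ord0 0 = 0 by rewrite mxE.
  have v_max : v ord_max 0 = 0 by rewrite mxE -val_eqE /= eqSS gtn_eqF // ltnW.
  have [a] := diagonalizable_sq_scalar_pchar2 C2 BD (matMD_FF v0 v_max).
  rewrite matMD_newspace // => /(congr1 (fun w : 'cV_n => w (rev_ord (Ordinal lt1)) 0)).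
  rewrite mxE mul_matFE rev_ordK !mxE eqxx mulr1 -[_ == _]val_eqE /=.
  rewrite (_ : n - 2 == 1 = false)%N; last by apply/negbTE; lia.
  by rewrite mulr0 => /eqP; rewrite oppr_eq0 (negbTE (Ft_neq0 _)).
rewrite leq_eqVlt ltnS leqn0 => /orP[/eqP N1|/eqP N0].
  (* For [n = 3], [W] is the line of the middle unit vector, on which [F] acts by [(- t) ^+ q]. *)
  have s_neq_t : - (- t) ^+ q != t.
    rewrite -{2}[t]opprK (inj_eq oppr_inj) (oppr_pchar2 C2); apply/eqP.
    by rewrite -{2}[t]expr1 => /t_exp_inj q1; move: q_gt1; rewrite q1.
  apply: (@diagonalizable_of_roots _ _ _ [:: - (- t) ^+ q; 0; t]) => [|v /=].
    by rewrite /= !inE !negb_or oppr_eq0 Ft_neq0 s_neq_t [0 == t]eq_sym t_neq0.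
  have [w0 w_max] := matMD_into_newspace v; move: (_ - 0 *: _) w0 w_max => w w0 w_max.
  rewrite matMD_newspace // scaleNr opprK; apply/colP => i; rewrite [LHS]mxE [RHS]mxE.
  rewrite [X in X + _]mxE [X in _ + X]mxE.
  have [->|i0] := eqVneq i ord0; first by rewrite mul_matF0 w_max w0 !mulr0 oppr0 addr0.
  have [->|i_max] := eqVneq i ord_max; first by rewrite mul_matF_max w_max w0 !mulr0 oppr0 addr0.
  have i1 : val i = 1%N.
    by move: i0 i_max; rewrite -!val_eqE /=; case: i => i /=; lia.
  have rev_i : rev_ord i = i by apply: val_inj; rewrite /= i1 N1.
  rewrite mul_matFE rev_i /s_exp i1 mul1n add1n prednK ?addNr //; exact: ltnW.
(* For [n = 2], [W] is zero, so the factors for [t] and 0 suffice. *)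
apply: (@diagonalizable_of_roots _ _ _ [:: 0; t]) => [|v /=].
  by rewrite /= inE eq_sym t_neq0.
have [w0 w_max] := matMD_into_newspace v; move: (_ - 0 *: _) w0 w_max => w w0 w_max.
apply/colP => i; rewrite [RHS]mxE.
have [->//|i0] := eqVneq i ord0; have [->//|] := eqVneq i ord_max.
by move: i0; rewrite -!val_eqE /=; case: i => i /=; lia.
Qed.

Lemma newspace_dim_le1 :
  (N <= 1)%N <-> exists2 d, has_dim (Ker T `&` Img F (Ker T)) d & (d <= 1)%N.
Proof.
split=> [|[d [e [rangeE _]] d_le]].
  rewrite leq_eqVlt ltnS leqn0 => /orP[/eqP N1|/eqP N0].
    have lt1 : (1 < n)%N by [].
    have N_neq0 : (N == 0)%N = false by rewrite N1.
    exists 1%N => //; exists (fun=> delta_mx (Ordinal lt1) 0); split; last first.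
      move=> x y /(congr1 (fun w : 'cV_n => w (Ordinal lt1) 0)).
      rewrite /lin_comb !big_ord1 !mxE !eqxx !mulr1 => xy.
      by apply/colP => i; rewrite [i]ord1.
    apply/seteqP; split=> [_ [x _ <-]|v /newspaceE [v0 v_max]].
      rewrite newspaceE /lin_comb big_ord1 !mxE -!val_eqE /= N1; split; exact: mulr0.
    exists (\col_i v (Ordinal lt1) 0) => //; rewrite /lin_comb big_ord1 !mxE.
    apply/colP => i; rewrite !mxE eqxx andbT.
    have [->|i0] := eqVneq i ord0; first by rewrite v0 mulr0.
    have [->|i_max] := eqVneq i ord_max; first by rewrite v_max -val_eqE /= eqSS N_neq0 mulr0.
    have -> : i = Ordinal lt1 by apply/val_inj; move: i0 i_max; rewrite -!val_eqE /=; case: i => i /=; lia.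
    by rewrite eqxx mulr1.
  exists 0%N => //; exists (fun=> 0); split; last by move=> x y _; apply/colP => -[].
  apply/seteqP; split=> [_ [x _ <-]|v /newspaceE [v0 v_max]].
    by rewrite newspaceE /lin_comb big_ord0 !mxE.
  exists 0 => //; rewrite /lin_comb big_ord0; apply/colP => i; rewrite mxE.
  have [->//|i0] := eqVneq i ord0; have [->//|] := eqVneq i ord_max.
  by move: i0; rewrite -!val_eqE /=; case: i => i /=; lia.
rewrite leqNgt; apply/negP => N_gt1.
(* For [N >= 2] the unit vectors of indices 1 and 2 lie in [W], and they are not multiples of one
   vector. *)
have lt1 : (1 < n)%N by []. have lt2 : (2 < n)%N by rewrite !ltnS ltnW.
have delta_comb i : i != ord0 -> i != ord_max -> exists x, lin_comb e x = delta_mx i 0.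
  move=> i0 i_max; have : (Ker T `&` Img F (Ker T)) (delta_mx i 0).
    by rewrite newspaceE !mxE ![_ == i]eq_sym (negbTE i0) (negbTE i_max).
  by rewrite -rangeE => -[x _ <-]; exists x.
have [||x xE] := delta_comb (Ordinal lt1); [by []|by rewrite -val_eqE /=; lia|].
have [||y yE] := delta_comb (Ordinal lt2); [by []|by rewrite -val_eqE /=; lia|].
move: d e d_le x y xE yE {rangeE delta_comb} => [|[|//]] e _ x y; rewrite /lin_comb.
  by rewrite big_ord0 => /colP/(_ (Ordinal lt1)); rewrite !mxE !eqxx => /esym/eqP; rewrite oner_eq0.
rewrite !big_ord1 => xE yE.
have := congr1 (fun w : 'cV_n => w (Ordinal lt1) 0) xE.
have := congr1 (fun w : 'cV_n => w (Ordinal lt2) 0) xE.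
have := congr1 (fun w : 'cV_n => w (Ordinal lt2) 0) yE.
rewrite !mxE !eqxx -!val_eqE /= => y2 /eqP.
rewrite mulf_eq0 => /orP[/eqP->|/eqP e2]; last by move: y2; rewrite e2 mulr0 => /esym/eqP; rewrite oner_eq0.
by rewrite mul0r => /esym/eqP; rewrite oner_eq0.
Qed.

End Coordinates.

(** * Dimension of subspaces in coordinates *)

Lemma lin_comb_comp (C : fieldType) (V : lmodType C) n d (e : 'I_n -> V)
    (x : 'I_d -> 'cV[C]_n) y :
  lin_comb (fun i => lin_comb e (x i)) y = lin_comb e (lin_comb x y).
Proof.
rewrite /lin_comb; under eq_bigr do rewrite scaler_sumr.
rewrite exchange_big; apply: eq_bigr => i _; rewrite summxE scaler_suml.
by apply: eq_bigr => l _; rewrite scalerA mxE.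
Qed.

Lemma has_dim_lin_comb (C : fieldType) (V : lmodType C) n (e : 'I_n -> V)
    (W : set 'cV[C]_n) d :
  injective (lin_comb e) -> has_dim (lin_comb e @` W) d <-> has_dim W d.
Proof.
move=> e_inj; split=> [[f [rangeE f_inj]]|[x [rangeE x_inj]]].
  (* The basis vectors of the image come from coordinate vectors, which form a basis of [W]. *)
  have fE i : exists x, lin_comb e x = f i.
    have : (lin_comb e @` W) (f i).
      rewrite -rangeE; exists (delta_mx i 0) => //; rewrite /lin_comb (bigD1 i) //= mxE !eqxx scale1r.
      by rewrite big1 ?addr0 // => l /negbTE li; rewrite mxE li scale0r.
    by case=> x _ <-; exists x.
  have [x xE] := choice fE; have {}xE : f = fun i => lin_comb e (x i) by apply/funext => i.
  exists x; split; last first.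
    by move=> y z yz; apply: f_inj; rewrite xE !lin_comb_comp yz.
  apply/seteqP; split=> [_ [y _ <-]|v Wv].
    have : (lin_comb e @` W) (lin_comb f y) by rewrite -rangeE; exists y.
    by rewrite xE lin_comb_comp => -[w Ww /e_inj <-].
  have : (lin_comb e @` W) (lin_comb e v) by exists v.
  rewrite -rangeE xE => -[y _]; rewrite lin_comb_comp => /e_inj <-; by exists y.
exists (fun i => lin_comb e (x i)); split.
  rewrite -rangeE; apply/seteqP; split=> [_ [y _ <-]|_ [_ [y _ <-] <-]].
    by rewrite lin_comb_comp; exists (lin_comb x y) => //; exists y.
  by exists y => //; rewrite lin_comb_comp.
by move=> y z; rewrite !lin_comb_comp => /e_inj/x_inj.
Qed.

(** * Matrices of size two *)

(** The layout of [mat2] over any ring, in particular over [F_q[t]]. *)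
Definition mx22 (A : nzRingType) (a b c d : A) : 'M[A]_2 :=
  \matrix_(i < 2, l < 2)
    if i == 0 then (if l == 0 then a else b) else (if l == 0 then c else d).

Lemma det2 (A : comNzRingType) (g : 'M[A]_2) :
  \det g = g 0 0 * g 1 1 - g 0 1 * g 1 0.
Proof.
rewrite (expand_det_row _ 0) !big_ord_recl big_ord0 addr0 /cofactor !det_mx11 !mxE.
have -> : lift ord0 ord0 = 1 :> 'I_2 by apply: val_inj.
have -> : lift 1 0 = 0 :> 'I_2 by apply: val_inj.
by rewrite expr0 expr1 mul1r mulN1r mulrN.
Qed.

Lemma mul2E (A : nzRingType) (g h : 'M[A]_2) i l :
  (g *m h) i l = g i 0 * h 0 l + g i 1 * h 1 l.
Proof. by rewrite mxE !big_ord_recl big_ord0 addr0; congr (_ + g _ _ * h _ _); apply: val_inj. Qed.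

Lemma ord2P (P : 'I_2 -> Prop) : P 0 -> P 1 -> forall i, P i.
Proof.
move=> P0 P1 [[|[|//]] i_lt]; first by rewrite (_ : Ordinal i_lt = 0) //; apply: val_inj.
by rewrite (_ : Ordinal i_lt = 1) //; apply: val_inj.
Qed.

Lemma matrix2P (A : Type) (g h : 'M[A]_2) :
  g 0 0 = h 0 0 -> g 0 1 = h 0 1 -> g 1 0 = h 1 0 -> g 1 1 = h 1 1 -> g = h.
Proof.
move=> e00 e01 e10 e11; apply/matrixP => i l; move: i l.
by apply: (ord2P (P := fun i => forall l, g i l = h i l)); apply: ord2P.
Qed.

(** * Slash operators, cosets of [Gamma0t] and traces *)

Section Forms.
Variables (R : realType) (Fq : finFieldType) (C : fieldType).
Variables (iota : {rmorphism {fraction {poly Fq}} -> C}) (abs : C -> R).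
Hypothesis hC : is_Cinf iota abs.
Local Notation Kinf := (Kinf iota abs).
Local Notation embA := (embA iota).
Local Notation embM := (embM iota).
Local Notation t := (tC iota).
Implicit Types (x y z : C) (P Q : {poly Fq}) (f : C -> C^o) (g h : 'M[C]_2).

Lemma embAD P Q : embA (P + Q) = embA P + embA Q.
Proof. by rewrite /embA !rmorphD. Qed.
Lemma embAM P Q : embA (P * Q) = embA P * embA Q.
Proof. by rewrite /embA !rmorphM. Qed.
Lemma embAN P : embA (- P) = - embA P.
Proof. by rewrite /embA !rmorphN. Qed.
Lemma embA0 : embA 0 = 0. Proof. by rewrite /embA !rmorph0. Qed.
Lemma embA1 : embA 1 = 1. Proof. by rewrite /embA !rmorph1. Qed.

Lemma embA_eq0 P : (embA P == 0) = (P == 0).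
Proof. by rewrite /embA fmorph_eq0 tofrac_eq0. Qed.

Lemma embAX P i : embA (P ^+ i) = embA P ^+ i.
Proof. by rewrite /embA !rmorphXn. Qed.

Lemma tC_neq0 : t != 0. Proof. by rewrite embA_eq0 polyX_eq0. Qed.

Lemma tC_free i : (0 < i)%N -> t ^+ i != 1.
Proof.
move=> i0; rewrite -embAX -subr_eq0 -embA1 -embAN -embAD embA_eq0.
by rewrite -size_poly_eq0 size_XnsubC.
Qed.

Lemma pchar_C p : p \in [pchar Fq] -> p \in [pchar C].
Proof.
move=> pF.
exact: (rmorph_pchar iota (rmorph_pchar (@tofrac _) (rmorph_pchar polyC pF))).
Qed.

Let abs0 : abs 0 = 0. Proof. exact/(abs_eq0P hC). Qed.
Let abs_gt0 x : x != 0 -> 0 < abs x.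
Proof.
move=> x0; rewrite lt_neqAle (abs_pos hC) andbT eq_sym.
by apply: contra_neq x0 => /(abs_eq0P hC).
Qed.
Let absN x : abs (- x) = abs x.
Proof.
have := abs_at_infty hC (P := - 1); rewrite oppr_eq0 oner_eq0 => /(_ isT).
by rewrite embAN embA1 size_polyN size_poly1 expr0 => N1; rewrite -mulN1r (abs_mul hC) N1 mul1r.
Qed.
Let abs_lt e x y : abs x < e -> abs y < e -> abs (x + y) < e.
Proof. by move=> xe ye; apply: le_lt_trans (abs_ultra hC x y) _; rewrite gt_max xe. Qed.

Lemma Kinf_iota a : Kinf (iota a).
Proof. by move=> e e0; exists a; rewrite subrr abs0. Qed.

Lemma Kinf_embA P : Kinf (embA P). Proof. exact: Kinf_iota. Qed.

Lemma KinfD x y : Kinf x -> Kinf y -> Kinf (x + y).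
Proof.
move=> Kx Ky e e0; have [a xa] := Kx e e0; have [b yb] := Ky e e0.
by exists (a + b); rewrite rmorphD opprD addrACA; apply: abs_lt.
Qed.

Lemma KinfM x y : Kinf x -> Kinf y -> Kinf (x * y).
Proof.
move=> Kx Ky e e0.
(* [b] comes before [a], whose tolerance depends on it; the added 1 keeps the denominators
   positive. *)
have [b yb] := Ky (e / (abs x + 1)) (divr_gt0 e0 (ltr_wpDl (abs_pos hC x) ltr01)).
have [a xa] := Kx (e / (abs (iota b) + 1)) (divr_gt0 e0 (ltr_wpDl (abs_pos hC _) ltr01)).
exists (a * b); rewrite rmorphM.
have -> : x * y - iota a * iota b = x * (y - iota b) + (x - iota a) * iota b by ring.
have half u v : abs v < e / (abs u + 1) -> abs u * abs v < e.
  have := abs_pos hC u; have := abs_pos hC v => v0 u0.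
  rewrite ltr_pdivlMr; last by lra.
  by move=> ve; apply: le_lt_trans ve; rewrite mulrC ler_wpM2l //; lra.
by apply: abs_lt; rewrite (abs_mul hC); [|rewrite mulrC]; apply: half.
Qed.

Lemma KinfV x : Kinf x -> Kinf x^-1.
Proof.
move=> Kx e e0; have [->|x0] := eqVneq x 0; first by exists 0; rewrite invr0 rmorph0 subrr abs0.
have ax := abs_gt0 x0.
(* The first bound gives [abs x <= abs (iota a)] by the ultrametric inequality; the second then
   controls [abs (x - iota a) / abs (x * iota a)]. *)
have e1 : 0 < Num.min (abs x) (e * abs x ^+ 2) by rewrite lt_min ax mulr_gt0 // exprn_gt0.
have [a] := Kx _ e1.
rewrite lt_min => /andP[xa xa2].
have ax_le : abs x <= abs (iota a).
  rewrite leNgt; apply/negP => ax_lt; have := abs_lt xa ax_lt.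
  by rewrite subrK ltxx.
have a0 : iota a != 0 by apply: contraTneq ax_le => ->; rewrite abs0 -ltNge.
exists a^-1; rewrite fmorphV -(ltr_pM2r (mulr_gt0 ax (abs_gt0 a0))) -!(abs_mul hC).
have -> : (x^-1 - (iota a)^-1) * (x * iota a) = - (x - iota a) by field; rewrite x0 a0.
rewrite absN (abs_mul hC); apply: lt_le_trans xa2 _.
by rewrite ler_pM2l // expr2 ler_pM2l.
Qed.

Definition Kinf_matrix g := forall i l, Kinf (g i l).

Lemma Kinf_embM (G : 'M[{poly Fq}]_2) : Kinf_matrix (embM G).
Proof. by move=> i l; rewrite mxE; apply: Kinf_embA. Qed.

Definition moebius g z := (g 0 0 * z + g 0 1) / (g 1 0 * z + g 1 1).

Lemma Kinf_moebius g z : Kinf_matrix g -> Kinf z -> Kinf (moebius g z).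
Proof. by move=> Kg Kz; apply: KinfM; last apply: KinfV; apply: KinfD; rewrite //; apply: KinfM. Qed.

(** Otherwise the bottom row is zero or [z = - d / c] lies in [Kinf]. *)
Lemma denom_neq0 g z : Kinf_matrix g -> \det g != 0 -> ~ Kinf z -> g 1 0 * z + g 1 1 != 0.
Proof.
move=> Kg dg Kz; apply/eqP => cz.
have [c0|c0] := eqVneq (g 1 0) 0.
  by move/eqP: dg; apply; rewrite det2; move: cz; rewrite c0 mul0r add0r => ->; rewrite !mulr0 subrr.
apply: Kz; have -> : z = (- g 1 1) / g 1 0.
  by apply: (mulfI c0); rewrite mulrCA divff // mulr1; apply/eqP; rewrite -addr_eq0 cz.
by apply: KinfM; [rewrite -mulN1r -embA1 -embAN; apply: KinfM => //; apply: Kinf_embA|apply: KinfV].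
Qed.

Variables (k : nat) (m : int).
Local Notation slash := (slash k m).
Local Notation on_Omega := (on_Omega iota abs).

(** This includes a pole of [g], where the quotient is 0 by convention and so lies in [Kinf]. *)
Lemma on_Omega_slash f g : on_Omega f -> Kinf_matrix g -> on_Omega (slash f g).
Proof. by move=> fO Kg z Kz; rewrite /slash (fO _ (Kinf_moebius Kg Kz)) !mul0r. Qed.

Lemma slash_slash f g h : on_Omega f -> Kinf_matrix g -> Kinf_matrix h ->
  \det g != 0 -> \det h != 0 -> slash (slash f g) h = slash f (g *m h).
Proof.
move=> fO Kg Kh dg dh.
have Kgh : Kinf_matrix (g *m h).
  by move=> i l; rewrite mul2E; apply: KinfD; apply: KinfM.
have dgh : \det (g *m h) != 0 by rewrite det_mulmx mulf_neq0.
apply/funext => z; have [Kz|Kz] := pselect (Kinf z).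
  by rewrite !(on_Omega_slash _ _ Kz) //; apply: on_Omega_slash.
have d1 := denom_neq0 Kh dh Kz; have d2 := denom_neq0 Kgh dgh Kz.
(* Cocycle relation of the automorphy factor. *)
have den : g 1 0 * moebius h z + g 1 1 =
    ((g *m h) 1 0 * z + (g *m h) 1 1) / (h 1 0 * z + h 1 1).
  by rewrite /moebius !mul2E; field.
have mgh : moebius g (moebius h z) = moebius (g *m h) z.
  rewrite {1}/moebius den {2}/moebius; move: d2; rewrite !mul2E => d2; rewrite /moebius; field.
  by rewrite d2.
rewrite /slash -/(moebius h z) -/(moebius g _) -/(moebius _ z) mgh den.
rewrite det_mulmx expfzMl // exprMn exprVn invfM invrK.
have xk : (h 1 0 * z + h 1 1) ^+ k != 0 :> C by apply: expf_neq0.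
move: (_ ^+ k) xk (_ ^- k) => x x0 y; move: (f _ : C) (_ ^ m) (_ ^ m) => v e1 e2.
by field.
Qed.

Lemma slash1 f : slash f 1%:M = f.
Proof.
apply/funext => z; rewrite /slash !mxE /= !mul1r !mul0r !addr0 add0r divr1.
by rewrite det1 exp1rz expr1n invr1 !mulr1.
Qed.

Lemma slashD f1 f2 g : slash (f1 + f2) g = slash f1 g + slash f2 g.
Proof. by apply/funext => z; rewrite /slash !fctE !mulrDl. Qed.

Lemma slashZ c f g : slash (c *: f) g = c *: slash f g.
Proof.
apply/funext => z; rewrite /slash /=.
by rewrite -[RHS]/(c * (_ * _ * _)) !mulrA.
Qed.

Lemma slash_sum (I : finType) (f_ : I -> C -> C^o) g :
  slash (\sum_i f_ i) g = \sum_i slash (f_ i) g.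
Proof.
elim/big_rec2: _ => [|i h f _ <-]; last by rewrite slashD.
by apply/funext => z; rewrite /slash !mul0r.
Qed.

(** The set [R] in the definition of [Tr]: the last rows run through the projective line over [F_q],
    with [None] the point [(0 : 1)]. *)
Definition Gamma0t_coset_rep (o : option Fq) : 'M[{poly Fq}]_2 :=
  if o is Some b then mx22 0 (-1) 1 b%:P else 1%:M.
Local Notation rep := Gamma0t_coset_rep.

Lemma embM_mul (G H : 'M[{poly Fq}]_2) : embM (G *m H) = embM G *m embM H.
Proof.
by apply/matrixP => i l; rewrite mul2E mxE mul2E embAD !embAM !mxE.
Qed.

Lemma embM1 : embM 1%:M = 1%:M.
Proof. by apply: matrix2P; rewrite !mxE /= ?mulr1n ?mulr0n ?embA1 ?embA0. Qed.

Lemma det_embM (G : 'M[{poly Fq}]_2) : \det (embM G) = embA (\det G).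
Proof. by rewrite !det2 !mxE embAD embAN !embAM. Qed.

Lemma det_embM_neq0 (G : 'M[{poly Fq}]_2) : G \in unitmx -> \det (embM G) != 0.
Proof.
rewrite det_embM embA_eq0 unitmxE; apply: contraTneq => ->.
by rewrite unitr0.
Qed.

Lemma slash_slash_embM f (G H : 'M[{poly Fq}]_2) : on_Omega f ->
  G \in unitmx -> H \in unitmx ->
  slash (slash f (embM G)) (embM H) = slash f (embM (G *m H)).
Proof.
by move=> fO Gu Hu; rewrite embM_mul slash_slash ?det_embM_neq0 //; apply: Kinf_embM.
Qed.

Lemma rep_unit o : rep o \in unitmx.
Proof.
case: o => [b|]; last exact: unitmx1.
by rewrite unitmxE det2 !mxE /= mul0r mulr1 opprK add0r unitr1.
Qed.

(* The class in the projective line over Fq of the last row of G modulo t. *)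
Definition coset_index (G : 'M[{poly Fq}]_2) : option Fq :=
  if (G 1 0).[0] == 0 then None else Some ((G 1 1).[0] / (G 1 0).[0]).

Lemma dvdX P : ('X %| P)%R = (P.[0] == 0).
Proof. by rewrite -[X in X %| _]subr0 -polyC0 dvdp_XsubCl. Qed.

Lemma coset_index_rep (H : 'M[{poly Fq}]_2) : H \in unitmx ->
  exists2 G, Gamma0t G & H = G *m rep (coset_index H).
Proof.
move=> Hu; rewrite /coset_index; case: eqVneq => [c0|c0].
  by exists H; rewrite ?mulmx1 //; split=> //; rewrite dvdX c0.
(* The second factor is the inverse of [rep (Some b)]. With [b = d / c] modulo [t], the lower left
   entry [c b - d] of [G] is divisible by [t]. *)
set b := _ / _; pose G := H *m mx22 b%:P 1 (-1) 0.
exists G; last first.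
  by apply: matrix2P; rewrite !mul2E !mxE /=; ring.
split; rewrite ?dvdX /G.
  by rewrite unitmx_mul Hu unitmxE det2 !mxE /= mulr0 mulrN1 opprK add0r unitr1.
by rewrite mul2E !mxE /= hornerD !hornerM hornerN !hornerC mulrN1 /b mulrC divfK // subrr.
Qed.

(** The determinant formed by the two last rows modulo [t]; it detects whether they give the same
    projective point. *)
Let cross (G H : 'M[{poly Fq}]_2) :=
  (G 1 0).[0] * (H 1 1).[0] - (G 1 1).[0] * (H 1 0).[0].

Let cross_coset_index G H : coset_index G = coset_index H -> cross G H = 0.
Proof.
rewrite /coset_index /cross; case: eqVneq => [->|G0]; case: eqVneq => [->|H0] //=.
  by rewrite mul0r mulr0 subrr.
case=> E; have -> : (G 1 1).[0] = (H 1 1).[0] / (H 1 0).[0] * (G 1 0).[0] by rewrite -E divfK.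
by field.
Qed.

(** Right multiplication by [G] scales [cross] by [\det G], a nonzero constant, and [cross] is
    nonzero on two distinct representatives. *)
Lemma coset_index_inj (G : 'M[{poly Fq}]_2) : G \in unitmx ->
  injective (fun o => coset_index (rep o *m G)).
Proof.
move=> Gu o1 o2 /cross_coset_index.
have -> : cross (rep o1 *m G) (rep o2 *m G) = cross (rep o1) (rep o2) * (\det G).[0].
  rewrite /cross det2 !mul2E !hornerE; ring.
have dG : (\det G).[0] != 0.
  move: Gu; rewrite unitmxE poly_unitE => /andP[/eqP s1].
  by rewrite {2}(size1_polyC (eq_leq s1)) hornerC unitfE.
move/eqP; rewrite mulf_eq0 (negbTE dG) orbF /cross.
case: o1 o2 => [b|] [d|] //=; rewrite !mxE /= !hornerE ?mul1r ?mulr1 ?mul0r ?mulr0.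
- by rewrite subr_eq0 => /eqP ->.
- by rewrite subr0 oner_eq0.
- by rewrite oppr_eq0 oner_eq0.
Qed.

Lemma sum_option (V : nmodType) (I : finType) (F_ : option I -> V) :
  \sum_o F_ o = F_ None + \sum_i F_ (Some i).
Proof.
rewrite (bigD1 None) //=; congr (_ + _).
rewrite (reindex_omap Some id) //=; last by case.
by apply: eq_bigl => i; rewrite eqxx.
Qed.

Local Notation Trace := (Trace iota k m).
Local Notation Fricke := (Fricke iota k m).

Lemma Trace_cosets f : Trace f = \sum_o slash f (embM (rep o)).
Proof.
rewrite sum_option embM1 slash1 /Trace; congr (_ + _); apply: eq_bigr => b _.
by congr slash; apply: matrix2P; rewrite !mxE /= ?embAN ?embA1 ?embA0.
Qed.

Lemma Trace_invariant f (G : 'M[{poly Fq}]_2) : on_Omega f ->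
  (forall H, Gamma0t H -> slash f (embM H) = f) ->
  G \in unitmx -> slash (Trace f) (embM G) = Trace f.
Proof.
move=> fO f_inv Gu; rewrite Trace_cosets slash_sum.
rewrite [RHS](reindex_inj (coset_index_inj Gu)); apply: eq_bigr => o _.
have ru := rep_unit o; have rGu : rep o *m G \in unitmx by rewrite unitmx_mul ru.
have [H [Hu HX] HE] := coset_index_rep rGu.
by rewrite slash_slash_embM // {1}HE -slash_slash_embM ?rep_unit // f_inv.
Qed.

(** All [q + 1] terms equal [f], and [q = 0] in [C]. *)
Lemma Trace_of_invariant f : (#|Fq|%:R = 0 :> C) ->
  (forall G : 'M[{poly Fq}]_2, G \in unitmx -> slash f (embM G) = f) -> Trace f = f.
Proof.
move=> q0 f_inv; rewrite Trace_cosets sum_option embM1 slash1.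
under eq_bigr do rewrite f_inv ?rep_unit //.
by rewrite sumr_const -scaler_nat q0 scale0r addr0.
Qed.

Let W := mat2 0 (-1) t 0.
Let KW : Kinf_matrix W.
Proof.
apply: ord2P; apply: ord2P; rewrite mxE /=; try exact: Kinf_embA.
- by rewrite -embA0; exact: Kinf_embA.
- by rewrite -embA1 -embAN; exact: Kinf_embA.
- by rewrite -embA0; exact: Kinf_embA.
Qed.
Let detW : \det W = t.
Proof. by rewrite det2 !mxE /= mul0r mulN1r opprK add0r. Qed.

Lemma Trace'E f : on_Omega f -> (-1) ^+ k = 1 :> C ->
  Trace' iota k m f = Fricke f + t ^ (m - k%:Z) *: Ut iota f.
Proof.
move=> fO k1; rewrite /Trace' /Trace; congr (_ + _).
have tm : t ^ (m - k%:Z) = t ^ m / t ^+ k by rewrite expfzDr ?tC_neq0 // -invr_expz.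
rewrite /Ut (_ : (fun z => _) = \sum_(b : Fq) (fun z => f ((z + embA b%:P) / t))); last first.
  by apply/funext => z; rewrite fct_sumE.
rewrite scaler_sumr; apply: eq_bigr => b _; rewrite /Fricke slash_slash //; first last.
- by rewrite det2 !mxE /= mul0r sub0r mulN1r opprK oner_neq0.
- by rewrite detW tC_neq0.
- have -> : mat2 0 (-1) 1 (embA b%:P) = embM (rep (Some b)); last exact: Kinf_embM.
  by apply: matrix2P; rewrite !mxE /= ?embAN ?embA1 ?embA0.
(* This matrix acts as [z -> (z + b) / t], with determinant [t] and automorphy factor [- t], whose
   sign disappears in the [k]-th power. *)
have -> : W *m mat2 0 (-1) 1 (embA b%:P) = mx22 (- 1) (- embA b%:P) 0 (- t).
  by apply: matrix2P; rewrite !mul2E !mxE /=; ring.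
apply/funext => z; rewrite /slash det2 !mxE /= mul0r add0r mulr0 subr0 mulrNN mul1r mulN1r.
rewrite -opprD invrN mulrNN -[RHS]/(_ * f _) tm exprNn k1 mul1r.
by rewrite -mulrA mulrC.
Qed.

(** The Fricke matrix is [J] times [diag(t, 1)], and [J] fixes [f]. *)
Lemma deltat_Fricke f : on_Omega f ->
  (forall G : 'M[{poly Fq}]_2, G \in unitmx -> slash f (embM G) = f) ->
  deltat iota m f = Fricke f.
Proof.
move=> fO f_inv; pose J : 'M[{poly Fq}]_2 := mx22 0 (-1) 1 0.
pose tD := embM (mx22 'X 0 0 1).
have Ju : J \in unitmx by rewrite unitmxE det2 !mxE /= mul0r mulr1 opprK add0r unitr1.
have -> : Fricke f = slash f (embM J *m tD).
  by congr slash; apply: matrix2P; rewrite mul2E !mxE /= ?embAN ?embA1 ?embA0 /tC; ring.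
have dtD : \det tD != 0.
  by rewrite det_embM embA_eq0 det2 !mxE /= mulr1 mulr0 subr0 polyX_eq0.
rewrite -(slash_slash fO (Kinf_embM J) (Kinf_embM _) (det_embM_neq0 Ju) dtD) f_inv //.
apply/funext => z; rewrite /slash /deltat /tD det_embM det2 !mxE /= embA0 embA1.
by rewrite mulr1 mulr0 subr0 mul0r addr0 add0r divr1 expr1n invr1 mulr1 mulrC.
Qed.

End Forms.

(** * Linear operators and direct sums in coordinates *)

Section LinComb.
Variables (C : fieldType) (V : lmodType C) (n : nat) (e : 'I_n -> V).

Lemma lin_combD x y : lin_comb e (x + y) = lin_comb e x + lin_comb e y.
Proof. by rewrite -big_split; apply: eq_bigr => i _; rewrite mxE scalerDl. Qed.

Lemma lin_combZ c x : lin_comb e (c *: x) = c *: lin_comb e x.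
Proof. by rewrite /lin_comb scaler_sumr; apply: eq_bigr => i _; rewrite mxE scalerA. Qed.

Lemma lin_comb0 : lin_comb e 0 = 0.
Proof. by rewrite -[X in lin_comb e X](scale0r 0) lin_combZ scale0r. Qed.

Lemma has_matrix_lin_comb (op : V -> V) B x :
  (forall v w, op (v + w) = op v + op w) -> (forall c v, op (c *: v) = c *: op v) ->
  has_matrix e op B -> op (lin_comb e x) = lin_comb e (B *m x).
Proof.
move=> opD opZ opB.
have -> : B *m x = lin_comb (fun i => col i B) x.
  apply/colP => i; rewrite mxE summxE; apply: eq_bigr => l _.
  by rewrite !mxE mulrC.
rewrite -lin_comb_comp /lin_comb; elim/big_rec2: _ => [|i v w _ <-].
  by have := opZ 0 0; rewrite !scale0r.
by rewrite opD opZ opB.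
Qed.

Lemma is_direct_sum_lin_comb (W W1 W2 : set 'cV[C]_n) : injective (lin_comb e) ->
  is_direct_sum W W1 W2 ->
  is_direct_sum (lin_comb e @` W) (lin_comb e @` W1) (lin_comb e @` W2).
Proof.
move=> e_inj [-> W12]; split; apply/seteqP; split.
- move=> _ [_ [v1 W1v [v2 W2v ->]] <-]; rewrite lin_combD.
  by exists (lin_comb e v1); [exists v1|exists (lin_comb e v2); [exists v2|]].
- move=> _ [_ [v1 W1v <-] [_ [v2 W2v <-] ->]]; rewrite -lin_combD.
  by exists (v1 + v2) => //; exists v1 => //; exists v2.
- move=> _ [[v1 W1v <-] [v2 W2v /e_inj E]]; move: E W2v => -> W2v.
  have : (W1 `&` W2) v1 by split.
  by rewrite W12 => ->; rewrite lin_comb0.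
- have [W10 W20] : (W1 `&` W2) 0 by rewrite W12.
  by move=> _ ->; split; exists 0; rewrite ?lin_comb0.
Qed.

End LinComb.

(** * Cusp forms in an adapted basis *)

Section Identification.
Variables (R : realType) (Fq : finFieldType) (C : fieldType).
Variables (iota : {rmorphism {fraction {poly Fq}} -> C}) (abs : C -> R).
Hypothesis hC : is_Cinf iota abs.
Variables (p r q N : nat).
Hypotheses (p_prime : prime p) (q_def : q = (p ^ r)%N) (r_gt0 : (0 < r)%N).
Hypotheses (card_Fq : #|Fq| = q) (N_le : (N <= q)%N).
Variable m : int.
Local Notation n := N.+2.
Local Notation k := (2 + n.-1 * q.-1)%N.
Local Notation t := (tC iota).
Local Notation M := (matM C q 0 n).
Local Notation D := (matD t q 0 n).
Local Notation A := (matA C 0 n).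
Local Notation F := (matF t q 0 n).
Local Notation T := (matT C q 0 n).
Local Notation S := (cusp_form iota abs (@Gamma0t Fq) k m).
Variable e : 'I_n -> C -> C^o.
Hypothesis he : adapted_basis iota abs k m 0 e.
Local Notation E := (lin_comb e).
Local Notation c := (t ^ (m - k%:Z)).

Lemma pchar_Cinf : p \in [pchar C].
Proof. by apply: (pchar_C iota); apply: card_finPcharP p_prime; rewrite card_Fq q_def. Qed.

Let pC := pchar_Cinf.
Let t0 : t != 0 := tC_neq0 iota.
Let c0 : c != 0. Proof. by rewrite expfz_neq0. Qed.
Let Ft0 : (- t) ^+ k != 0. Proof. by rewrite expf_neq0 // oppr_eq0. Qed.

Let E_inj : injective E. Proof. by case: he => -[]. Qed.
Let E_range : range E = S. Proof. by case: he => -[]. Qed.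
Let SE x : S (E x). Proof. by rewrite -E_range; exists x. Qed.

Lemma Fricke_lin_comb x : Fricke iota k m (E x) = E (c *: (F *m x)).
Proof.
case: he => _ _ hF; rewrite (has_matrix_lin_comb _ _ _ hF) ?card_Fq ?scalemxAl //.
- by move=> f g; apply: slashD.
- by move=> a f; apply: slashZ.
Qed.

Lemma Ut_lin_comb x : Ut iota (E x) = E (M *m D *m x).
Proof.
case: he => _ hU _; rewrite (has_matrix_lin_comb _ _ _ hU) ?card_Fq //.
- by move=> f g; apply/funext => z; apply: big_split.
- by move=> a f; apply/funext => z; rewrite -[RHS]/(a * Ut iota f z) mulr_sumr.
Qed.

Lemma Trace'_lin_comb x : Trace' iota k m (E x) = E (c *: (T *m (F *m x))).
Proof.
have k1 : (-1) ^+ k = 1 :> C.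
  by rewrite exprD sqrrN expr1n mul1r mulnC exprM (signr_predq pC q_def r_gt0) expr1n.
have [xO _ _ _] := SE x.
rewrite (Trace'E hC) // Fricke_lin_comb Ut_lin_comb -lin_combZ -lin_combD -scalerDr.
by rewrite (mul_matMD _ pC q_def r_gt0) [F *m x + _]addrC subrK.
Qed.

Lemma Fricke_preimage x :
  Fricke iota k m (E (c^-1 *: ((- t) ^- k *: (F *m x)))) = E x.
Proof.
rewrite Fricke_lin_comb -!scalemxAr mul_matFF !scalerA.
by rewrite mulVKf // mulVf // scale1r.
Qed.

(** By [Fricke_preimage] every form is a Fricke image, so the matrix of [Tr] follows from that of
    [Tr' = Tr o Fr]. *)
Lemma Trace_lin_comb x : Trace iota k m (E x) = E (T *m x).
Proof.
rewrite -{1}(Fricke_preimage x) -[LHS]/(Trace' iota k m (E _)) Trace'_lin_comb.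
by rewrite -!scalemxAr mul_matFF -scalemxAr !scalerA divfK // divff // scale1r.
Qed.

(** [M A x = 0] means that [Tr] fixes the form. Analyticity and vanishing at the cusps are the same
    conditions at both levels, so only invariance is at stake. *)
Lemma GL2A_cusp_lin_comb x : cusp_form iota abs (@GL2A Fq) k m (E x) <-> Ker (M *m A) x.
Proof.
rewrite Ker_matMA; have [xO xr x_inv xv] := SE x; split=> [[_ _ inv _]|Tx].
  apply: E_inj; rewrite -Trace_lin_comb; apply: Trace_of_invariant => //.
  by apply/eqP; rewrite -(dvdn_pcharf pC) card_Fq q_def dvdn_exp.
split=> // G Gu; rewrite -Tx -Trace_lin_comb.
exact: (Trace_invariant hC).
Qed.

Lemma S_new_lin_comb : S_new iota abs k m = E @` (Ker T `&` Img F (Ker T)).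
Proof.
have KerE B x : E (B *m x) = 0 <-> Ker B x by rewrite -(lin_comb0 e); split=> [/E_inj|->].
have mem x : S_new iota abs k m (E x) <-> (Ker T `&` Img F (Ker T)) x.
  rewrite /setI /mkset (Img_matF _ t0 (@Ker_scale _ _ T)).
  rewrite /S_new /mkset Trace_lin_comb Trace'_lin_comb lin_combZ.
  split=> [[_ /KerE Tx /eqP]|[/KerE Tx /KerE TFx]].
    by rewrite scaler_eq0 (negbTE c0) => /eqP/KerE.
  by split=> //; rewrite TFx scaler0.
apply/seteqP; split=> [f fN|_ [x xW <-]]; last exact/mem.
have [] : range E f by rewrite E_range; case: fN.
by move=> x _ xf; exists x => //; apply/mem; rewrite xf.
Qed.

(** On level-one forms [deltat] is the Fricke involution, and [F] maps [Ker (M A)] onto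
    [Ker (M D)]. *)
Lemma S_old_lin_comb : S_old iota abs k m = E @` sum_space (Ker (M *m A)) (Ker (M *m D)).
Proof.
have cuspE f : cusp_form iota abs (@GL2A Fq) k m f -> exists2 x, Ker (M *m A) x & f = E x.
  move=> fG; have : S f by case: fG => fO fr inv fv; split=> // G [Gu _]; apply: inv.
  by rewrite -E_range => -[x _ xf]; exists x => //; apply/GL2A_cusp_lin_comb; rewrite xf.
have deltatE x : Ker (M *m A) x -> deltat iota m (E x) = Fricke iota k m (E x).
  move=> /GL2A_cusp_lin_comb[xO _ inv _]; exact: (deltat_Fricke hC).
apply/seteqP; split.
  move=> _ [_ /cuspE[x xA ->] [_ /cuspE[y yA ->] ->]]; rewrite deltatE // Fricke_lin_comb.
  rewrite -lin_combD; exists (x + c *: (F *m y)) => //; exists x => //.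
  exists (c *: (F *m y)) => //; apply/Ker_scale/(Ker_matMD _ pC q_def r_gt0).
  by rewrite mul_matFF; apply: Ker_scale.
move=> _ [_ [x xA [y yD ->]] <-]; rewrite lin_combD.
have yA : Ker (M *m A) (c^-1 *: ((- t) ^- k *: (F *m y))).
  by do 2 apply: Ker_scale; apply/(Ker_matMD _ pC q_def r_gt0).
exists (E x); first exact/GL2A_cusp_lin_comb.
exists (E (c^-1 *: ((- t) ^- k *: (F *m y)))); first exact/GL2A_cusp_lin_comb.
by rewrite deltatE // Fricke_preimage.
Qed.

End Identification.

(** * Assembly in coordinates and transfer to cusp forms *)

Theorem corollary5p11
  (p r q : nat) (hp : prime p) (hr : (0 < r)%N) (hq : q = (p ^ r)%N)
  (R : realType) (Fq : finFieldType) (hFq : #|Fq| = q)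
  (C : fieldType) (iota : {rmorphism {fraction {poly Fq}} -> C})
  (abs : C -> R) (hC : is_Cinf iota abs)
  (n : nat) (hn : (2 <= n <= q + 2)%N)
  (k : nat) (hk : k = (2 + n.-1 * q.-1)%N)
  (m : int) (hm : (m = 1 %[mod q.-1])%Z) :
  let t := tC iota in
  let M := matM C q 0 n in
  let D := matD t q 0 n in
  let A := matA C 0 n in
  let F := matF t q 0 n in
  let T := matT C q 0 n in
  let S := cusp_form iota abs (@Gamma0t Fq) k m in
  let Sold := S_old iota abs k m in
  let Snew := S_new iota abs k m in
  (* 1 *)
  (Ker (M *m A) `&` Ker (F + M *m D) = Ker (M *m A) `&` Img F (Ker (1%:M + M *m A))
   /\ Ker (M *m A) `&` Img F (Ker (1%:M + M *m A)) = [set 0])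
  /\
  (* 2, q odd *)
  (odd q -> diagonalizable (M *m D))
  /\
  (* 3, in coordinates *)
  (is_direct_sum [set: 'cV[C]_n]
     (sum_space (Ker (M *m A)) (Ker (M *m D))) (Ker T `&` Img F (Ker T))
   /\ is_direct_sum (sum_space (Ker (M *m A)) (Ker (M *m D)))
        (Ker (M *m A)) (Ker (M *m D)))
  /\
  (forall e : 'I_n -> C -> C^o, adapted_basis iota abs k m 0 e ->
     (* 2, q even *)
     (~~ odd q ->
        (diagonalizable (M *m D) <-> exists2 d, has_dim Snew d & (d <= 1)%N))
     /\
     (* 3, in S *)
     [/\ is_direct_sum S Sold Snew,
         lin_comb e @` sum_space (Ker (M *m A)) (Ker (M *m D)) = Sold
       & lin_comb e @` (Ker T `&` Img F (Ker T)) = Snew]).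
Proof.
case: n hn hk => [|[|N]] // hN hk t M D A F T S Sold Snew.
have pC := pchar_Cinf iota hp hq hFq.
have N_le : (N <= q)%N by move: hN; rewrite addn2 !ltnS.
have t0 : t != 0 := tC_neq0 iota.
have t_free : forall i, (0 < i)%N -> t ^+ i != 1 by exact: tC_free.
have direct := old_new_direct t0 pC hq hr N_le t_free.
split.
  split; first exact: (setI_KerMA_KerFMD _ t0 pC hq hr).
  exact: (setI_KerMA_FKerT t0 pC hq hr N_le).
split; first exact: (diagonalizable_odd t0 pC hq hr N_le t_free).
split; first by split=> //; exact: (oldspace_direct t0 pC hq hr N_le).
rewrite {}/Sold {}/Snew {}/S hk => e he.
have e_inj : injective (lin_comb e) by case: he => -[].
have rangeE : range (lin_comb e) = cusp_form iota abs (@Gamma0t Fq) (2 + N.+1 * q.-1) m.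
  by case: he => -[].
have newE := S_new_lin_comb hC hp hq hr hFq he.
have oldE := S_old_lin_comb hC hp hq hr hFq he.
split=> [q_even|]; last first.
  split; [|exact/esym|exact/esym].
  by rewrite -rangeE oldE newE; apply: is_direct_sum_lin_comb.
rewrite newE; apply: iff_trans (diagonalizable_even t0 pC hq hr N_le t_free q_even) _.
apply: iff_trans (newspace_dim_le1 t0 pC hq hr N_le t_free) _.
by split=> -[d dimd d1]; exists d => //; apply/(has_dim_lin_comb _ _ e_inj).
Qed.
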